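(* Assume the standing assumptions (A1)–(A4) listed in the context, and that $\mathcal{S}_2$ is $(\kappa,\rho)$-weakly sharp with $\kappa>0$, $\rho\in(1,2)$; let $\frac1{\rho^*}=1-\frac1\rho$. Let $\theta\in(0,1]$, $\alpha=1-\theta$, $\gamma\in(0,1)$. Let the algorithm described in the context use the constant step size $\tau_k=\bar\tau\in\big(0,\frac{\sqrt\theta\,\gamma}{L_1}\big]$ and the regularization sequence $$\beta_k=\frac{a}{(k+b)^\delta},\qquad a,b>0,\ k\ge0,\ \delta\in(0,1/2),\ \delta>1-\frac1\rho=\frac1{\rho^*}.$$ Let $\mathcal{U}_1,\mathcal{U}_2,x^*,p^*$, the constants $C_{\mathcal{U}_1},C_{\mathcal{U}_2}$, and the complexity bounds $W_{\rm Feas}$, $W_{\rm Opt}$ be as defined in the context. Then, as $K\to\infty$, $$W_{\rm Feas}(K,x_0,x^*,\mathcal{U}_2)\le O\big((K+b)^{-\delta}\big)\qquad\text{and}\qquad W_{\rm Opt}(K,x_0,x^*,\mathcal{U}_1)\le O\big((K+b)^{-(1-2\delta)}\big).$$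
   Context: **Problem.** $\mathcal{X}$ is a finite-dimensional real vector space with Euclidean inner product $\langle\cdot,\cdot\rangle$ and norm $\|\cdot\|$; $F_1,F_2:\mathcal{X}\to\mathcal{X}$ and $g_1,g_2:\mathcal{X}\to(-\infty,\infty]$. For a set-valued operator $M$, $\mathrm{zer}(M)=\{x:0\in M(x)\}$; $\mathrm{N}_C$ is the normal cone of a closed convex set $C$; $\mathtt{s}(u|C)=\sup_{y\in C}\langle u,y\rangle$; $\mathrm{dist}(x,C)=\inf_{y\in C}\|x-y\|$. Put $\mathcal{S}_2=\mathrm{zer}(F_2+\partial g_2)$, and let $\mathcal{S}_1$ be the set of solutions of the hierarchical problem: find $x^*\in\mathcal{S}_2$ such that $\langle F_1(x^* ),x-x^*\rangle+g_1(x)-g_1(x^* )\ge0$ for all $x\in\mathcal{S}_2$. **Gap functions.** $H^{(F,g)}(x,y)=\langle F(y),x-y\rangle+g(x)-g(y)$; $\Theta_{\rm Feas}(x|C)=\sup_{y\in C}H^{(F_2,g_2)}(x,y)$; $\Theta_{\rm Opt}(x|C)=\sup_{y\in C}H^{(F_1,g_1)}(x,y)$; $\varphi^{(F_2,g_2)}(x,u)=\sup_{y\in\mathrm{dom}(g_2)}\{H^{(F_2,g_2)}(x,y)+\langle y,u\rangle\}$. **Weak sharpness.** $\mathcal{S}_2$ is $(\kappa,\rho)$-weakly sharp if $H^{(F_2,g_2)}(z,z^* )\ge\kappa\rho^{-1}\mathrm{dist}(z,\mathcal{S}_2)^\rho$ for all $z^*\in\mathcal{S}_2$ and $z\in\mathrm{dom}(g_2)$.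 **Combined data.** $V_k=\beta_kF_1+F_2$, $G_k=\beta_kg_1+g_2$. **Standing assumptions.** (A1) $\mathcal{S}_1\ne\emptyset$ (in particular $\mathcal{S}_2\neq\emptyset$); $g_1,g_2$ are proper, convex, lower semicontinuous; $F_i$ is monotone and $L_{F_i}$-Lipschitz, $i=1,2$; $F_i=\sum_{a\in\mathcal{A}}F_i^a$ for a finite index set $\mathcal{A}$ and given maps $F_i^a:\mathcal{X}\to\mathcal{X}$. (A2) $\mathrm{dom}(g_1)\cap\mathrm{dom}(g_2)$ is closed, and for all compact $\mathcal{B},\mathcal{C}\subset\mathrm{dom}(g_1)\cap\mathrm{dom}(g_2)$, $\sup_{(x,y)\in\mathcal{B}\times\mathcal{C}}|g_1(x)-g_1(y)|<\infty$. (A3) $\mathcal{S}_1=\mathrm{zer}(F_1+\partial g_1+\mathrm{N}_{\mathcal{S}_2})$. (A4) For each $k$, $V_k$ has a stochastic oracle $V_k^\xi$ ($\xi$ a random variable with law $Q$) such that $\mathbb{E}[V_k^\xi(x)]=V_k(x)$ for all $x\in\mathcal{X}$, and there is $\mathcal{L}_k>0$ with $\mathbb{E}[\|V_k^\xi(x)-V_k^\xi(y)\|^2]\le\mathcal{L}_k^2\|x-y\|^2$ for all $x,y\in\mathcal{X}$; moreover $\sup_{k\ge0}\mathcal{L}_k\le L_1$ for a constant $L_1$. **Algorithm.** $\mathrm{prox}_g(x)=\mathrm{argmin}_y\{g(y)+\frac12\|y-x\|^2\}$. Start from a deterministic point $x_0=w_0\in\mathcal{X}$. For $k=0,1,\dots$: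 sample $\xi_k\sim Q$ independently of the past, and set $z_k=\alpha x_k+(1-\alpha)w_k$, $y_{k+1}=\mathrm{prox}_{\tau_kG_k}(z_k-\tau_kV_k(w_k))$, $x_{k+1}=\mathrm{prox}_{\tau_kG_k}\big(z_k-\tau_k(V_k(w_k)+V_k^{\xi_k}(y_{k+1})-V_k^{\xi_k}(w_k))\big)$, and, by an independent coin flip, $w_{k+1}=x_{k+1}$ with probability $\theta$ and $w_{k+1}=w_k$ with probability $1-\theta$. **Complexity bounds.** $\mathcal{U}_1\subseteq\mathrm{dom}(g_1)$ is nonempty compact with $\mathcal{U}_1\cap\mathcal{S}_1\ne\emptyset$; $\mathcal{U}_2\subseteq\mathrm{dom}(g_2)$ is nonempty compact with $\mathcal{U}_2\cap\mathcal{S}_2\neq\emptyset$; $x^*\in\mathcal{S}_1$, $p^*\in\mathrm{N}_{\mathcal{S}_2}(x^* )$; $h_k=\sup_{x\in\mathcal{S}_2}\varphi^{(F_2,g_2)}(x,\beta_kp^* )-\mathtt{s}(\beta_kp^*|\mathcal{S}_2)$; $T_K=\sum_{k=0}^{K-1}\tau_k$; $\bar y^K=T_K^{-1}\sum_{k=0}^{K-1}\tau_ky_{k+1}$; $$W_{\rm Feas}(K,x_0,x^*,\mathcal{U}_2)=\frac{7}{4T_K}\max_{x\in\mathcal{U}_2}\|x-x_0\|^2+\frac{7}{2T_K(1-\gamma)}\sum_{k=0}^\infty\tau_kh_k+C_{\mathcal{U}_2}\frac{\sum_{k=0}^{K-1}\tau_k\beta_k}{T_K}+\frac{7}{2T_K(1-\gamma)}\|x^*-x_0\|^2,$$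 $$W_{\rm Opt}(K,x_0,x^*,\mathcal{U}_1)=\frac{C_{\mathcal{U}_1}}{2T_K\beta_K}+\frac{3}{4T_K}\max_{x\in\mathcal{U}_1\cap\mathcal{S}_2}\|x-x_0\|^2+\frac{7}{2(1-\gamma)T_K\beta_K^2}\|x^*-x_0\|^2+\frac{7}{2(1-\gamma)T_K\beta_K^2}\sum_{k=0}^\infty\tau_kh_k.$$ Here $p^*$ and the constants $C_{\mathcal{U}_1},C_{\mathcal{U}_2}>0$, which do not depend on $K$, are such that $\mathbb{E}[\Theta_{\rm Feas}(\bar y^K|\mathcal{U}_2)]\le W_{\rm Feas}(K,x_0,x^*,\mathcal{U}_2)$ and $\mathbb{E}[\Theta_{\rm Opt}(\bar y^K|\mathcal{U}_1\cap\mathcal{S}_2)]\le W_{\rm Opt}(K,x_0,x^*,\mathcal{U}_1)$ for all $K\ge1$. *)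

(* Defs.v *)
From HB Require Import structures.
From mathcomp Require Import all_boot all_order all_algebra.
From mathcomp Require Import all_classical all_reals all_analysis.
Set Implicit Arguments.
Unset Strict Implicit.
Unset Printing Implicit Defensive.
Import Order.TTheory GRing.Theory Num.Theory.
Import numFieldNormedType.Exports.
Local Open Scope classical_set_scope.
Local Open Scope ring_scope.

(* The finite-dimensional Euclidean space is 'rV[R]_n.  Its library norm is the
   sup norm, so the inner product and the Euclidean norm are defined here; the
   topology of 'rV[R]_n is the usual one. *)
Definition dot {R : realType} {n : nat} (u v : 'rV[R]_n) : R :=
  \sum_(i < n) u 0 i * v 0 i.

Definition enorm {R : realType} {n : nat} (u : 'rV[R]_n) : R :=
  Num.sqrt (dot u u).

(* inf of the real numbers; meaningful for nonempty C *)
Definition edist {R : realType} {n : nat} (x : 'rV[R]_n) (C : set 'rV[R]_n) : R :=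
  inf [set enorm (x - y) | y in C].

Definition dom {R : realType} {n : nat} (g : 'rV[R]_n -> \bar R) :
  set 'rV[R]_n := [set x | (g x < +oo)%E].

Definition proper_fun {R : realType} {n : nat} (g : 'rV[R]_n -> \bar R) : Prop :=
  dom g !=set0 /\ forall x, (-oo < g x)%E.

Definition convex_fun {R : realType} {n : nat} (g : 'rV[R]_n -> \bar R) : Prop :=
  forall (x y : 'rV[R]_n) (t : R), 0 <= t <= 1 ->
    (g (t *: x + (1 - t) *: y)%R <= t%:E * g x + (1 - t)%:E * g y)%E.

Definition monotone_op {R : realType} {n : nat} (F : 'rV[R]_n -> 'rV[R]_n) : Prop :=
  forall x y, 0 <= dot (F x - F y) (x - y).

Definition lipschitz_op {R : realType} {n : nat} (L : R)
    (F : 'rV[R]_n -> 'rV[R]_n) : Prop :=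
  forall x y, enorm (F x - F y) <= L * enorm (x - y).

(* Set-valued operators are maps into sets; addition is Minkowski addition. *)
Definition single_op {R : realType} {n : nat} (F : 'rV[R]_n -> 'rV[R]_n) :
  'rV[R]_n -> set 'rV[R]_n := fun x => [set F x].

Definition add_op {R : realType} {n : nat} (M N : 'rV[R]_n -> set 'rV[R]_n) :
  'rV[R]_n -> set 'rV[R]_n := fun x => [set u + v | u in M x & v in N x].

Definition zer {R : realType} {n : nat} (M : 'rV[R]_n -> set 'rV[R]_n) :
  set 'rV[R]_n := [set x | M x 0].

(* Empty outside dom g when g is proper: then the right-hand side is +oo. *)
Definition subdiff {R : realType} {n : nat} (g : 'rV[R]_n -> \bar R) :
    'rV[R]_n -> set 'rV[R]_n :=
  fun x => [set u | forall y, (g x + (dot u (y - x))%:E <= g y)%E].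

Definition normal_cone {R : realType} {n : nat} (C : set 'rV[R]_n) :
    'rV[R]_n -> set 'rV[R]_n :=
  fun x => [set p | C x /\ forall y, C y -> dot p (y - x) <= 0].

Definition support_fun {R : realType} {n : nat} (u : 'rV[R]_n)
    (C : set 'rV[R]_n) : \bar R :=
  ereal_sup [set (dot u y)%:E | y in C].

(* In \bar R, r - +oo = -oo for every r, including r = +oo.  In particular,
   0 <= gapH F g x y forces y to be in dom g. *)
Definition gapH {R : realType} {n : nat} (F : 'rV[R]_n -> 'rV[R]_n)
    (g : 'rV[R]_n -> \bar R) (x y : 'rV[R]_n) : \bar R :=
  ((dot (F y) (x - y))%:E + g x - g y)%E.

Definition Theta {R : realType} {n : nat} (F : 'rV[R]_n -> 'rV[R]_n)
    (g : 'rV[R]_n -> \bar R) (C : set 'rV[R]_n) (x : 'rV[R]_n) : \bar R :=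
  ereal_sup [set gapH F g x y | y in C].

Definition phi {R : realType} {n : nat} (F : 'rV[R]_n -> 'rV[R]_n)
    (g : 'rV[R]_n -> \bar R) (x u : 'rV[R]_n) : \bar R :=
  ereal_sup [set (gapH F g x y + (dot y u)%:E)%E | y in dom g].

Definition lower_sol {R : realType} {n : nat} (F2 : 'rV[R]_n -> 'rV[R]_n)
    (g2 : 'rV[R]_n -> \bar R) : set 'rV[R]_n :=
  zer (add_op (single_op F2) (subdiff g2)).

Definition hier_sol {R : realType} {n : nat} (F1 : 'rV[R]_n -> 'rV[R]_n)
    (g1 : 'rV[R]_n -> \bar R) (S2 : set 'rV[R]_n) : set 'rV[R]_n :=
  [set xs | S2 xs /\
    forall x, S2 x -> (0 <= (dot (F1 xs) (x - xs))%:E + g1 x - g1 xs)%E].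

Definition weakly_sharp {R : realType} {n : nat} (F2 : 'rV[R]_n -> 'rV[R]_n)
    (g2 : 'rV[R]_n -> \bar R) (S2 : set 'rV[R]_n) (kappa rho : R) : Prop :=
  forall zs z, S2 zs -> dom g2 z ->
    ((kappa * rho^-1 * (edist z S2) `^ rho)%:E <= gapH F2 g2 z zs)%E.

Definition combV {R : realType} {n : nat} (beta : nat -> R)
    (F1 F2 : 'rV[R]_n -> 'rV[R]_n) (k : nat) (x : 'rV[R]_n) : 'rV[R]_n :=
  beta k *: F1 x + F2 x.

Definition combG {R : realType} {n : nat} (beta : nat -> R)
    (g1 g2 : 'rV[R]_n -> \bar R) (k : nat) (x : 'rV[R]_n) : \bar R :=
  ((beta k)%:E * g1 x + g2 x)%E.

Definition prox_argmin {R : realType} {n : nat} (g : 'rV[R]_n -> \bar R)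
    (x : 'rV[R]_n) : set 'rV[R]_n :=
  [set p | forall y, (g p + (2^-1 * enorm (p - x) ^+ 2)%:E
                      <= g y + (2^-1 * enorm (y - x) ^+ 2)%:E)%E].

(* The argmin is a singleton when g is proper, convex and lsc; [get] selects
   its element. *)
Definition prox {R : realType} {n : nat} (g : 'rV[R]_n -> \bar R)
    (x : 'rV[R]_n) : 'rV[R]_n := get (prox_argmin g x).

Definition scale_fun {R : realType} {n : nat} (t : R)
    (g : 'rV[R]_n -> \bar R) (x : 'rV[R]_n) : \bar R := (t%:E * g x)%E.

(* The vector expectation is taken coordinatewise. *)
Record stochastic_oracle {R : realType} {n : nat} {d : measure_display}
    {Xi : measurableType d} (Q : probability Xi R)
    (V : 'rV[R]_n -> 'rV[R]_n) (Vs : Xi -> 'rV[R]_n -> 'rV[R]_n) (L : R) : Prop := {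
  oracle_integrable : forall (x : 'rV[R]_n) (j : 'I_n),
    Q.-integrable setT (fun s => (Vs s x 0 j)%:E);
  oracle_unbiased : forall (x : 'rV[R]_n) (j : 'I_n),
    ('E_Q[fun s => (Vs s x 0 j)%R] = (V x 0 j)%:E)%E;
  oracle_mean_lipschitz : forall x y : 'rV[R]_n,
    ('E_Q[fun s => (enorm (Vs s x - Vs s y) ^+ 2)%R]
       <= (L ^+ 2 * enorm (x - y) ^+ 2)%:E)%E }.

Definition random_vector {R : realType} {n : nat} {d : measure_display}
    {Omega : measurableType d} (X : Omega -> 'rV[R]_n) : Prop :=
  forall j : 'I_n, measurable_fun setT (fun o => X o 0 j).

Definition independent_events {R : realType} {d : measure_display}
    {Omega : measurableType d} (P : probability Omega R)
    (A B : set (set Omega)) : Prop :=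
  forall a b, A a -> B b -> P (a `&` b) = (P a * P b)%E.

Definition sigma_of {d d' : measure_display} {Omega : measurableType d}
    {E : measurableType d'} (X : Omega -> E) : set (set Omega) :=
  preimage_set_system setT X measurable.

(* sigma-algebra generated by the samples and coins of the iterations j < k *)
Definition past {d d' : measure_display} {Omega : measurableType d}
    {Xi : measurableType d'} (xi : nat -> Omega -> Xi)
    (coin : nat -> Omega -> bool) (k : nat) : set (set Omega) :=
  <<s \bigcup_(j in [set j | (j < k)%N])
        (sigma_of (xi j) `|` sigma_of (coin j)) >>.

(* x, y, w are the processes x_k, y_k, w_k; the algorithm does not define y_0.
   coin k = true is the event that w_(k+1) is set to x_(k+1). *)
Record algorithm_run {R : realType} {n : nat} {d d' : measure_display}
    {Omega : measurableType d} {Xi : measurableType d'}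
    (P : probability Omega R) (Q : probability Xi R)
    (V : nat -> 'rV[R]_n -> 'rV[R]_n) (G : nat -> 'rV[R]_n -> \bar R)
    (Vs : nat -> Xi -> 'rV[R]_n -> 'rV[R]_n)
    (tau : nat -> R) (alpha theta : R) (x0 : 'rV[R]_n)
    (xi : nat -> Omega -> Xi) (coin : nat -> Omega -> bool)
    (x y w : nat -> Omega -> 'rV[R]_n) : Prop := {
  run_xi_measurable : forall k, measurable_fun setT (xi k);
  run_xi_law : forall k (A : set Xi), measurable A -> P (xi k @^-1` A) = Q A;
  run_xi_indep : forall k,
    independent_events P (sigma_of (xi k)) (past xi coin k);
  run_coin_measurable : forall k, measurable_fun setT (coin k);
  run_coin_law : forall k, P [set o | coin k o] = theta%:E;
  run_coin_indep : forall k,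
    independent_events P (sigma_of (coin k))
      <<s past xi coin k `|` sigma_of (xi k) >>;
  run_x_random : forall k, random_vector (x k);
  run_y_random : forall k, random_vector (y k);
  run_w_random : forall k, random_vector (w k);
  run_x0 : forall o, x 0%N o = x0;
  run_w0 : forall o, w 0%N o = x0;
  run_y : forall k o,
    let z := alpha *: x k o + (1 - alpha) *: w k o in
    y k.+1 o = prox (scale_fun (tau k) (G k)) (z - tau k *: V k (w k o));
  run_x : forall k o,
    let z := alpha *: x k o + (1 - alpha) *: w k o in
    x k.+1 o = prox (scale_fun (tau k) (G k))
      (z - tau k *: (V k (w k o) + Vs k (xi k o) (y k.+1 o)
                     - Vs k (xi k o) (w k o)));
  run_w : forall k o, w k.+1 o = if coin k o then x k.+1 o else w k o }.

Definition sumT {R : realType} (tau : nat -> R) (K : nat) : R :=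
  \sum_(0 <= k < K) tau k.

Definition ybar {R : realType} {n : nat} {Omega : Type} (tau : nat -> R)
    (y : nat -> Omega -> 'rV[R]_n) (K : nat) (o : Omega) : 'rV[R]_n :=
  (sumT tau K)^-1 *: \sum_(0 <= k < K) tau k *: y k.+1 o.

Definition hseq {R : realType} {n : nat} (F2 : 'rV[R]_n -> 'rV[R]_n)
    (g2 : 'rV[R]_n -> \bar R) (S2 : set 'rV[R]_n) (beta : nat -> R)
    (ps : 'rV[R]_n) (k : nat) : \bar R :=
  (ereal_sup [set phi F2 g2 x (beta k *: ps) | x in S2]
   - support_fun (beta k *: ps) S2)%E.

Definition maxdist2 {R : realType} {n : nat} (U : set 'rV[R]_n)
    (x0 : 'rV[R]_n) : \bar R :=
  ereal_sup [set (enorm (x - x0) ^+ 2)%:E | x in U].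

(* The bounds are extended reals: finiteness of the series and of the maxima
   is not presupposed. *)
Definition WFeas {R : realType} {n : nat} (tau beta : nat -> R)
    (h : nat -> \bar R) (gamma C : R) (K : nat) (x0 xs : 'rV[R]_n)
    (U2 : set 'rV[R]_n) : \bar R :=
  let T := sumT tau K in
  ((7 / (4 * T))%:E * maxdist2 U2 x0
   + (7 / (2 * T * (1 - gamma)))%:E * (\sum_(0 <= k <oo) (tau k)%:E * h k)
   + (C * ((\sum_(0 <= k < K) tau k * beta k) / T))%:E
   + (7 / (2 * T * (1 - gamma)) * enorm (xs - x0) ^+ 2)%:E)%E.

Definition WOpt {R : realType} {n : nat} (tau beta : nat -> R)
    (h : nat -> \bar R) (gamma C : R) (K : nat) (x0 xs : 'rV[R]_n)
    (U1 S2 : set 'rV[R]_n) : \bar R :=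
  let T := sumT tau K in
  ((C / (2 * T * beta K))%:E
   + (3 / (4 * T))%:E * maxdist2 (U1 `&` S2) x0
   + (7 / (2 * (1 - gamma) * T * beta K ^+ 2) * enorm (xs - x0) ^+ 2)%:E
   + (7 / (2 * (1 - gamma) * T * beta K ^+ 2))%:E
     * (\sum_(0 <= k <oo) (tau k)%:E * h k))%E.

(* u <= O(e) as K tends to infinity *)
Definition le_bigO {R : realType} (u : nat -> \bar R) (e : nat -> R) : Prop :=
  exists2 f : nat -> R^o, f =O_\oo (e : nat -> R^o) &
    \forall K \near \oo, (u K <= (f K)%:E)%E.

(* Main.v *)
Require Import Defs.
From HB Require Import structures.
From mathcomp Require Import all_boot all_order all_algebra.
From mathcomp Require Import all_classical all_reals all_analysis.
From mathcomp Require Import ring lra.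
Import Order.TTheory GRing.Theory Num.Theory.
Import numFieldNormedType.Exports.
Local Open Scope classical_set_scope.
Local Open Scope ring_scope.

(** Both bounds are explicit in [K] except for the two maxima and for the
    series of the [tau k * h k], so the point is that these are finite; the
    rates are then read off from [T_K] being proportional to [K] and
    [beta k] to [(k + b) ^ (- delta)].

    The maxima are finite because a compact set is bounded ([maxdist2_le]).
    The series is where weak sharpness enters.  Let [x] be in [S2], [y] in the
    domain of [g2], and [d] the distance from [y] to [S2].  Monotonicity of
    [F2] gives [H(x, y) <= - H(y, x)], and sharpness bounds this by
    [- kappa / rho * d ^ rho].  As [p*] is normal to [S2] at [x*], the linear
    term [beta k * <y, p*>] exceeds the support function of [beta k * p*] by
    at most [beta k * |p*| * d].  A penalty of order [d ^ rho] thus competes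
    with a gain of order [beta k * d], and Young's inequality with the
    conjugate exponents [rho] and [rhos] leaves [h k = O(beta k ^ rhos)]
    ([hseq_le]).  Since also [h k >= 0] ([hseq_ge0]), the series is dominated
    by that of [(k + b) ^ (- delta * rhos)], which converges because
    [delta * rhos > 1]: this is exactly the lower bound imposed on [delta].

    The sums of powers are compared with integrals through one inequality,
    [powR_increment].  With exponent [delta * rhos > 1] it yields the
    convergence just used, and with exponent [delta < 1] it bounds the partial
    sums of [beta] by a multiple of [(K + b) ^ (1 - delta)].  After division by
    [T_K], this average of [beta] decays like [(K + b) ^ (- delta)] and
    dominates the other terms of the feasibility bound, which are of order
    [1 / K].  In the optimality bound the slowest terms are those in
    [1 / (T_K * beta K ^ 2)], of order [(K + b) ^ (2 * delta - 1)]. *)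

(** * Sums of real powers *)

(** The function [t `^ p / p] is concave on the positive reals for every
    [p < 1] other than [0], whatever the sign of [p], so it lies below its
    tangent at [1].  For [p > 0] this is Young's inequality for [t `^ p] and
    [1]; for [p < 0] it follows from the tangents of the exponential and of the
    logarithm. *)
Lemma powR_tangent1 {R : realType} (p t : R) : p < 1 -> p != 0 -> 0 < t ->
  (t `^ p - 1) / p <= t - 1.
Proof.
move=> p1 p0 t0; case: (ltP 0 p) => [pgt|ple].
  rewrite ler_pdivrMr// lerBlDr.
  have := @conjugate_powR R (t `^ p) 1 p^-1 (1 - p)^-1 (powR_ge0 _ _) ler01.
  rewrite !invr_gt0 subr_gt0 pgt p1 => /(_ isT isT).
  rewrite !invrK powR1 /= -powRrM mulfV// powRr1 ?(ltW t0)// mul1r mulr1.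
  move=> /(_ ltac:(ring)); lra.
have plt : p < 0 by rewrite lt_neqAle p0.
rewrite ler_ndivrMr// lerBrDr.
have -> : t `^ p = expR (p * ln t) by rewrite /powR gt_eqF.
have := expR_ge1Dx (p * ln t); apply: le_trans.
rewrite addrC lerD2l mulrC ler_nM2l//.
by have := @le_ln1Dx R (t - 1); rewrite addrCA subrr addr0; apply; lra.
Qed.

(** By concavity, the increment of [x `^ p / p] over a unit step is at least
    the derivative at the right end; this is [powR_tangent1] at
    [t = x / (x + 1)], rescaled. *)
Lemma powR_increment {R : realType} (p x : R) : p < 1 -> p != 0 -> 0 < x ->
  (x + 1) `^ (p - 1) <= ((x + 1) `^ p - x `^ p) / p.
Proof.
move=> p1 p0 x0.
have x1 : 0 < x + 1 by lra.
have t0 : 0 < x / (x + 1) by rewrite divr_gt0.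
have := powR_tangent1 _ _ p1 p0 t0.
rewrite -[in X in _ -> _ <= (_ - X) / _](divfK (lt0r_neq0 x1) x).
rewrite (powRM _ (ltW t0) (ltW x1)) powRD ?(gt_eqF x1) ?implybT//.
rewrite powR_inv1 ?(ltW x1)//.
set u := (x / (x + 1)) `^ p; move=> H.
have -> : ((x + 1) `^ p - u * (x + 1) `^ p) / p =
    (x + 1) `^ p * - ((u - 1) / p) by ring.
rewrite ler_wpM2l ?powR_ge0// lerNr (le_trans H)//.
by rewrite le_eqVlt; apply/orP; left; apply/eqP; field; rewrite lt0r_neq0.
Qed.

(** Comparison of a sum with the integral of the power function.  Keeping the
    two ends of the integral lets one statement serve both the case [1 < s],
    where the right-hand side stays bounded, and the case [s < 1], where it
    gives the order of growth. *)
Lemma sum_powR_le {R : realType} (s b : R) (K : nat) : 0 < s -> s != 1 -> 0 < b ->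
  \sum_(0 <= k < K) (k%:R + b) `^ (- s)
    <= b `^ (- s) + ((K%:R + b) `^ (1 - s) - b `^ (1 - s)) / (1 - s).
Proof.
move=> s0 s1 b0.
have p0 : 1 - s != 0 by rewrite subr_eq0 eq_sym.
have p1 : 1 - s < 1 by lra.
have inc k : (k.+1%:R + b) `^ (- s) <=
    ((k.+1%:R + b) `^ (1 - s) - (k%:R + b) `^ (1 - s)) / (1 - s).
  have k0 : 0 < k%:R + b :> R by rewrite ltr_wpDl.
  have := powR_increment _ _ p1 p0 k0.
  by rewrite addrAC natr1 (_ : 1 - s - 1 = - s)//; ring.
(* The first term is split off, since each increment controls the power at the
   right end of its step. *)
case: K => [|K]; first by rewrite big_nil add0r subrr mul0r addr0 powR_ge0.
have le1 : \sum_(0 <= k < K.+1) (k%:R + b) `^ (- s) <=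
    b `^ (- s) + ((K%:R + b) `^ (1 - s) - b `^ (1 - s)) / (1 - s).
  rewrite big_nat_recl// add0r lerD2l.
  apply: (le_trans (ler_sum _ (fun k _ => inc k))).
  by rewrite -mulr_suml telescope_sumr// add0r.
apply: (le_trans le1); rewrite lerD2l.
have := le_trans (powR_ge0 _ _) (inc K).
rewrite !mulrBl; lra.
Qed.

(** Above exponent [1] the bound of [sum_powR_le] does not grow with the number
    of terms. *)
Lemma nneseries_powR_le {R : realType} (u : nat -> \bar R) (D s b : R) :
  1 < s -> 0 < b -> 0 <= D ->
  (forall k, 0 <= u k <= (D * (k%:R + b) `^ (- s))%:E)%E ->
  (\sum_(0 <= k <oo) u k
     <= (D * (b `^ (- s) + b `^ (1 - s) / (s - 1)))%:E)%E.
Proof.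
move=> s1 b0 D0 uD; apply: lime_le.
  by apply: is_cvg_nneseries => k _ _; case/andP: (uD k).
apply: nearW => K.
apply: (@le_trans _ _ (\sum_(0 <= k < K) (D * (k%:R + b) `^ (- s))%:E)%E).
  by apply: lee_sum => k _; case/andP: (uD k).
rewrite sumEFin lee_fin -mulr_sumr ler_wpM2l//.
have s0 : 0 < s by lra.
have s_neq1 : s != 1 by rewrite gt_eqF.
apply: le_trans (sum_powR_le _ _ K s0 s_neq1 b0) _.
have -> (A B : R) : (A - B) / (1 - s) = (B - A) / (s - 1).
  by field; lra.
rewrite lerD2l ler_pM2r ?invr_gt0 ?subr_gt0//.
by rewrite gerBl powR_ge0.
Qed.

(** * Inner product and distance *)

Lemma dotC {R : realType} {n : nat} (u v : 'rV[R]_n) : dot u v = dot v u.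
Proof. by apply: eq_bigr => i _; rewrite mulrC. Qed.

Lemma dotBr {R : realType} {n : nat} (u v w : 'rV[R]_n) :
  dot u (v - w) = dot u v - dot u w.
Proof.
by rewrite /dot -sumrB; apply: eq_bigr => i _; rewrite !mxE mulrBr.
Qed.

Lemma dotBl {R : realType} {n : nat} (u v w : 'rV[R]_n) :
  dot (u - v) w = dot u w - dot v w.
Proof. by rewrite dotC dotBr dotC [dot w v]dotC. Qed.

Lemma dotZl {R : realType} {n : nat} (c : R) (u v : 'rV[R]_n) :
  dot (c *: u) v = c * dot u v.
Proof.
by rewrite /dot mulr_sumr; apply: eq_bigr => i _; rewrite !mxE mulrA.
Qed.

Lemma dot_ge0 {R : realType} {n : nat} (u : 'rV[R]_n) : 0 <= dot u u.
Proof. by apply: sumr_ge0 => i _; rewrite -expr2 sqr_ge0. Qed.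

(** Cauchy-Schwarz inequality; expanding the squared norm of
    [dot v v *: u - dot u v *: v] avoids square roots. *)
Lemma dot_le_enorm {R : realType} {n : nat} (u v : 'rV[R]_n) :
  dot u v <= enorm u * enorm v.
Proof.
have := dot_ge0 v; rewrite le_eqVlt => /orP[/eqP v0|v0].
  have vi0 i : v 0 i = 0.
    have sq0 (j : 'I_n) : true -> 0 <= v 0 j * v 0 j.
      by move=> _; rewrite -expr2 sqr_ge0.
    have /eqP := psumr_eq0P sq0 (esym v0) (isT : xpredT i).
    by rewrite mulf_eq0 orbb => /eqP.
  rewrite /dot big1 => [|i _]; last by rewrite vi0 mulr0.
  by rewrite mulr_ge0 ?sqrtr_ge0.
apply: le_trans (ler_norm _) _.
rewrite -sqrtr_sqr /enorm -sqrtrM ?dot_ge0// ler_sqrt ?mulr_ge0 ?dot_ge0//.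
have := dot_ge0 (dot v v *: u - dot u v *: v).
rewrite dotBl !dotBr !dotZl ![dot _ (_ *: _)]dotC !dotZl [dot v u]dotC.
rewrite (_ : _ - _ = dot v v * (dot u u * dot v v - dot u v ^+ 2)).
  by rewrite pmulr_rge0// subr_ge0.
ring.
Qed.

Lemma edist_ge0 {R : realType} {n : nat} (x : 'rV[R]_n) (C : set 'rV[R]_n) :
  C !=set0 -> 0 <= Defs.edist x C.
Proof.
move=> [c Cc]; apply: lb_le_inf; first by exists (enorm (x - c)), c.
by move=> _ [z _ <-]; exact: sqrtr_ge0.
Qed.

(** For [c] in [C], normality gives [dot u c <= dot u c0], and Cauchy-Schwarz
    bounds [dot u (x - c)] by [enorm u * enorm (x - c)]; then [c] is taken to
    approach [x].  The constant is [enorm u + 1] so that it can be divided by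
    even when [u] vanishes. *)
Lemma dot_le_edist {R : realType} {n : nat} (C : set 'rV[R]_n)
    (u x c0 : 'rV[R]_n) :
  normal_cone C c0 u -> dot u x <= dot u c0 + (enorm u + 1) * Defs.edist x C.
Proof.
move=> [Cc0 uN].
have N0 : 0 < enorm u + 1 by rewrite ltr_wpDl ?sqrtr_ge0.
rewrite -lerBlDl mulrC -ler_pdivrMr//.
apply: lb_le_inf; first by exists (enorm (x - c0)), c0.
move=> _ [c Cc <-]; rewrite ler_pdivrMr//.
have := dot_le_enorm u (x - c); have := uN _ Cc; rewrite !dotBr.
have := sqrtr_ge0 (dot (x - c) (x - c)); rewrite -/(enorm _).
set e := enorm (x - c); nra.
Qed.

(** Young's inequality for the factors [kappa `^ (1 / rho) * d] and
    [c * kappa `^ (- (1 / rho))]: the scaling makes the first term on its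
    right-hand side equal to the penalty. *)
Lemma conjugate_bound {R : realType} (kappa rho rhos c d : R) :
  0 < kappa -> 1 < rho -> rhos^-1 = 1 - rho^-1 -> 0 <= c -> 0 <= d ->
  c * d - kappa * rho^-1 * d `^ rho
    <= (c * kappa `^ (- rho^-1)) `^ rhos / rhos.
Proof.
move=> k0 r1 rs c0 d0.
have r0 : 0 < rho by lra.
have rs0 : 0 < rhos by rewrite -invr_gt0 rs subr_gt0 invf_lt1.
have := @conjugate_powR R (kappa `^ rho^-1 * d) (c * kappa `^ (- rho^-1))
  rho rhos.
rewrite !mulr_ge0 ?powR_ge0// => /(_ isT isT r0 rs0).
move=> /(_ ltac:(rewrite rs; ring)).
rewrite (powRM _ (powR_ge0 _ _) d0) -powRrM mulVf ?gt_eqF// powRr1 ?(ltW k0)//.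
have -> : kappa `^ rho^-1 * d * (c * kappa `^ (- rho^-1)) = c * d.
  by rewrite powRN; field; rewrite gt_eqF ?powR_gt0.
lra.
Qed.

(** * The perturbation terms h *)

(** A point of the domain makes the subgradient inequality at [x] exclude the
    value [+oo]. *)
Lemma lower_sol_fin_num {R : realType} {n : nat} (F : 'rV[R]_n -> 'rV[R]_n)
    (g : 'rV[R]_n -> \bar R) (x : 'rV[R]_n) :
  proper_fun g -> lower_sol F g x -> g x \is a fin_num.
Proof.
move=> [[z gz] gN] [_ _ [v gv _]].
rewrite fin_numElt gN; have := le_lt_trans (gv z) gz.
by case: (g x) (gN x) => [r| |] //= _ _; rewrite ltry.
Qed.

(** Monotonicity of [F] gives [gapH F g x y <= - gapH F g y x], so sharpness,
    a lower bound on the gap at [x], becomes an upper bound on the gap with the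
    arguments exchanged. *)
Lemma gapH_lower_sol_le {R : realType} {n : nat} (F : 'rV[R]_n -> 'rV[R]_n)
    (g : 'rV[R]_n -> \bar R) (kappa rho : R) (x y : 'rV[R]_n) :
  proper_fun g -> monotone_op F -> weakly_sharp F g (lower_sol F g) kappa rho ->
  lower_sol F g x -> dom g y ->
  (gapH F g x y
     <= (- (kappa * rho^-1 * Defs.edist y (lower_sol F g) `^ rho))%:E)%E.
Proof.
move=> gp Fm sharp Sx gy; have := sharp x y Sx gy.
rewrite /gapH.
have /fineK <- := lower_sol_fin_num _ _ _ gp Sx.
have /fineK <- : g y \is a fin_num by rewrite fin_numElt gp.2 gy.
rewrite -!(EFinN, EFinD) !lee_fin.
have := Fm x y; rewrite dotBl !dotBr; lra.
Qed.

Lemma support_fun_normal {R : realType} {n : nat} (C : set 'rV[R]_n)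
    (c p : 'rV[R]_n) (t : R) : 0 <= t -> normal_cone C c p ->
  support_fun (t *: p) C = (t * dot p c)%:E.
Proof.
move=> t0 [Cc pN]; apply/eqP; rewrite eq_le; apply/andP; split.
  apply: ge_ereal_sup => _ [z Cz <-]; rewrite lee_fin dotZl ler_wpM2l//.
  by rewrite -subr_le0 -dotBr pN.
by apply: ereal_sup_ubound; exists c => //; rewrite dotZl.
Qed.

(** The supremum defining [hseq] contains the value of its objective at
    [x = y = c], where the gap vanishes and the linear term is the support
    function. *)
Lemma hseq_ge0 {R : realType} {n : nat} (F : 'rV[R]_n -> 'rV[R]_n)
    (g : 'rV[R]_n -> \bar R) (beta : nat -> R) (c p : 'rV[R]_n) (k : nat) :
  proper_fun g -> normal_cone (lower_sol F g) c p -> 0 <= beta k ->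
  (0 <= hseq F g (lower_sol F g) beta p k)%E.
Proof.
move=> gp pN b0; rewrite /hseq (support_fun_normal _ _ _ _ b0 pN).
have gc := lower_sol_fin_num _ _ _ gp pN.1.
rewrite sube_ge0//.
apply: (@le_trans _ _ (phi F g c (beta k *: p))).
  apply: ereal_sup_ubound; exists c; first by rewrite fin_numElt in gc; case/andP: gc.
  rewrite /gapH subrr -(fineK gc) -!(EFinN, EFinD); congr (_%:E).
  have -> : dot (F c) 0 = 0 by rewrite /dot big1// => i _; rewrite mxE mulr0.
  by rewrite dotC dotZl; ring.
by apply: ereal_sup_ubound; exists c => //; exact: pN.1.
Qed.

(** After subtraction of the support function, the objective of [hseq] is at
    most [beta k * (enorm p + 1) * d - kappa / rho * d `^ rho], where [d] is the
    distance from [y] to the solution set; [conjugate_bound] removes [d]. *)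
Lemma hseq_le {R : realType} {n : nat} (F : 'rV[R]_n -> 'rV[R]_n)
    (g : 'rV[R]_n -> \bar R) (kappa rho rhos : R) (beta : nat -> R)
    (c p : 'rV[R]_n) (k : nat) :
  proper_fun g -> monotone_op F -> 0 < kappa -> 1 < rho ->
  rhos^-1 = 1 - rho^-1 -> weakly_sharp F g (lower_sol F g) kappa rho ->
  normal_cone (lower_sol F g) c p -> 0 <= beta k ->
  (hseq F g (lower_sol F g) beta p k
     <= (((enorm p + 1) * kappa `^ (- rho^-1)) `^ rhos / rhos
          * beta k `^ rhos)%:E)%E.
Proof.
move=> gp Fm k0 r1 rs sharp pN b0.
rewrite /hseq (support_fun_normal _ _ _ _ b0 pN) leeBlDr//.
apply: ge_ereal_sup => _ [x Sx <-]; apply: ge_ereal_sup => _ [y gy <-].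
have := gapH_lower_sol_le _ _ _ _ _ _ gp Fm sharp Sx gy.
set d := Defs.edist y _ => Hgap.
have d0 : 0 <= d by apply: edist_ge0; exists c; exact: pN.1.
apply: le_trans (leeD2r _ Hgap) _.
rewrite -!EFinD lee_fin dotC dotZl.
have e0 : 0 <= enorm p + 1 by rewrite addr_ge0 ?sqrtr_ge0.
have be0 : 0 <= beta k * (enorm p + 1) by rewrite mulr_ge0.
have := conjugate_bound _ _ _ _ _ k0 r1 rs be0 d0.
rewrite -(mulrA _ _ (kappa `^ _)) (powRM _ b0 (mulr_ge0 e0 (powR_ge0 _ _))).
have := ler_wpM2l b0 (dot_le_edist _ _ y _ pN); rewrite -/d.
rewrite mulrDr; lra.
Qed.

(** With constant steps the series is dominated by that of
    [(k + b) `^ (- (delta * rhos))], and [1 < delta * rhos] makes it converge. *)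
Lemma nneseries_hseq_le {R : realType} {n : nat} (F : 'rV[R]_n -> 'rV[R]_n)
    (g : 'rV[R]_n -> \bar R) (kappa rho rhos : R) (tau beta : nat -> R)
    (t a b delta : R) (c p : 'rV[R]_n) :
  proper_fun g -> monotone_op F -> 0 < kappa -> 1 < rho ->
  rhos^-1 = 1 - rho^-1 -> rhos^-1 < delta ->
  weakly_sharp F g (lower_sol F g) kappa rho ->
  normal_cone (lower_sol F g) c p -> 0 < t -> 0 < a -> 0 < b ->
  (forall k, tau k = t) -> (forall k, beta k = a / (k%:R + b) `^ delta) ->
  exists2 M, 0 <= M &
    (\sum_(0 <= k <oo) (tau k)%:E * hseq F g (lower_sol F g) beta p k
       <= M%:E)%E.
Proof.
move=> gp Fm kappa0 rho1 rhosE delta_gt sharp pN t0 a0 b0 tauE betaE.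
have beta_ge0 k : 0 <= beta k by rewrite betaE divr_ge0 ?powR_ge0 ?ltW.
have rhos0 : 0 < rhos by rewrite -invr_gt0 rhosE subr_gt0 invf_lt1//; lra.
have s1 : 1 < delta * rhos by rewrite -ltr_pdivrMr// div1r.
pose D := t * (((enorm p + 1) * kappa `^ (- rho^-1)) `^ rhos / rhos
               * a `^ rhos).
have D0 : 0 <= D by rewrite !mulr_ge0 ?powR_ge0 ?invr_ge0// ltW.
exists (D * (b `^ (- (delta * rhos))
    + b `^ (1 - delta * rhos) / (delta * rhos - 1))).
  by rewrite mulr_ge0// addr_ge0 ?divr_ge0 ?powR_ge0//; lra.
apply: nneseries_powR_le => // k; apply/andP; split.
  rewrite mule_ge0 ?lee_fin ?tauE ?(ltW t0)//.
  exact: hseq_ge0 gp pN (beta_ge0 k).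
have hle := hseq_le _ _ _ _ _ _ _ _ k gp Fm kappa0 rho1 rhosE sharp pN
  (beta_ge0 k).
rewrite tauE; apply: le_trans (lee_wpmul2l _ hle) _; first by rewrite lee_fin ltW.
rewrite -EFinM lee_fin /D -!mulrA.
rewrite !ler_wpM2l ?(ltW t0) ?powR_ge0 ?invr_ge0 ?(ltW rhos0)//.
rewrite betaE powRM ?invr_ge0 ?powR_ge0 ?(ltW a0)//.
by rewrite -powRN -powRrM mulNr.
Qed.

(** * Rates of the two bounds *)

Lemma maxdist2_le {R : realType} {n : nat} (U : set 'rV[R]_n) (x0 : 'rV[R]_n) :
  compact U -> exists2 m, 0 <= m & (maxdist2 U x0 <= m%:E)%E.
Proof.
move=> /compact_bounded [M [_ HM]].
pose B := `|M| + 1.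
have B0 : 0 <= B by rewrite addr_ge0.
have HB : M < B by rewrite (le_lt_trans (ler_norm M))// ltrDl.
exists (\sum_(i < n) (B + `|x0 0 i|) ^+ 2).
  by apply: sumr_ge0 => i _; rewrite sqr_ge0.
apply: ge_ereal_sup => _ [x Ux <-]; rewrite lee_fin /enorm sqr_sqrtr ?dot_ge0//.
apply: ler_sum => i _; rewrite -expr2 !mxE -real_normK ?num_real//.
rewrite ler_sqr ?nnegrE ?addr_ge0//.
apply: le_trans (ler_normB _ _) _; rewrite lerD2r.
(* Points are bounded in the sup norm, which dominates each coordinate. *)
apply: le_trans (HM _ HB _ Ux).
rewrite [leRHS]mx_normrE.
by apply: (le_bigmax _ (fun ij : 'I_1 * 'I_n => `|x ij.1 ij.2|) (0, i)).
Qed.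

Lemma le_bigO_scale {R : realType} (u : nat -> \bar R) (e : nat -> R) (c : R) :
  (forall K, (0 < K)%N -> (u K <= (c * e K)%:E)%E) -> le_bigO u e.
Proof.
move=> uc; exists (fun K => c * e K); last first.
  by near=> K; apply: uc; near: K; exact: nbhs_infty_gt.
apply/eqO_exP; exists (`|c| + 1); first by rewrite ltr_wpDl.
by apply: nearW => K; rewrite normrM ler_wpM2r// lerDl.
Unshelve. all: by end_near. Qed.

Lemma sumT_cst {R : realType} (tau : nat -> R) (t : R) (K : nat) :
  (forall k, tau k = t) -> sumT tau K = K%:R * t.
Proof.
move=> tauE; rewrite /sumT (eq_bigr (fun=> t)) => [|k _]; last exact: tauE.
by rewrite big_const_nat subn0 iter_addr_0 mulr_natl.
Qed.

Lemma ler_powRDn {R : realType} (K : nat) (b r s : R) :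
  (0 < K)%N -> 0 < b -> r <= s -> (K%:R + b) `^ r <= (K%:R + b) `^ s.
Proof.
move=> K0 b0; apply: ler_powR.
by have : 1 <= K%:R :> R; [rewrite ler1n | lra].
Qed.

(** The quantity [K + b] is at most [(1 + b) * K] once [K] is positive, so
    dividing by [sumT tau K] costs one power of [K + b]. *)
Lemma sumTV_powR_le {R : realType} (tau : nat -> R) (t b q : R) (K : nat) :
  (forall k, tau k = t) -> (0 < K)%N -> 0 < b -> 0 < t ->
  (sumT tau K)^-1 * (K%:R + b) `^ q
    <= (1 + b) / t * (K%:R + b) `^ (q - 1).
Proof.
move=> tauE K0 b0 t0; have K1 : 1 <= K%:R :> R by rewrite ler1n.
have x0 : 0 < K%:R + b by lra.
rewrite powRD ?(gt_eqF x0) ?implybT// powR_inv1 ?(ltW x0)//.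
rewrite [leRHS]mulrCA [leLHS]mulrC ler_wpM2l ?powR_ge0//.
rewrite (sumT_cst _ _ _ tauE) -mulrA -invfM -div1r.
rewrite ler_pdivlMr ?mulr_gt0// mulrAC ler_pdivrMr ?mulr_gt0//; last lra.
have : 0 <= t * (b * (K%:R - 1)).
  by rewrite !mulr_ge0 ?subr_ge0 ?(ltW b0) ?(ltW t0).
lra.
Qed.

(** The average of [beta] is of order [(K + b) `^ (- delta)] and dominates the
    other terms, of order [1 / K]. *)
Lemma WFeas_le_bigO {R : realType} {n : nat} (tau beta : nat -> R)
    (h : nat -> \bar R) (gamma C t a b delta M m : R) (x0 xs : 'rV[R]_n)
    (U : set 'rV[R]_n) :
  (forall k, tau k = t) -> (forall k, beta k = a / (k%:R + b) `^ delta) ->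
  0 < t -> 0 < a -> 0 < b -> 0 < delta < 1 -> gamma < 1 -> 0 < C ->
  0 <= M -> (\sum_(0 <= k <oo) (tau k)%:E * h k <= M%:E)%E ->
  0 <= m -> (maxdist2 U x0 <= m%:E)%E ->
  le_bigO (fun K => WFeas tau beta h gamma C K x0 xs U)
          (fun K => (K%:R + b) `^ (- delta)).
Proof.
move=> tauE betaE t0 a0 b0 /andP[delta0 delta1] gamma1 C0 M0 HM m0 Hm.
have g0 : 0 < 1 - gamma by lra.
pose e := enorm (xs - x0) ^+ 2.
pose c := (1 + b) / t.
pose A := 7 / 4 * m + 7 / (2 * (1 - gamma)) * (M + e).
have A0 : 0 <= A.
  rewrite addr_ge0// mulr_ge0// ?divr_ge0 ?mulr_ge0 ?(ltW g0)//.
  by rewrite addr_ge0 ?sqr_ge0.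
pose c0 := b `^ (- delta) + (1 - delta)^-1.
have c00 : 0 <= c0 by rewrite addr_ge0 ?powR_ge0// invr_ge0; lra.
apply: (@le_bigO_scale _ _ _ (A * c + C * (t * a * c0 * c))) => K K0.
have T0 : 0 < sumT tau K by rewrite (sumT_cst _ _ _ tauE) mulr_gt0 ?ltr0n.
have Tx q := sumTV_powR_le _ _ _ q _ tauE K0 b0 t0.
set T := sumT tau K in T0 Tx *.
have T1 : T^-1 <= c * (K%:R + b) `^ (- delta).
  have := Tx 0; rewrite powRr0 mulr1 => H; apply: le_trans H _.
  rewrite ler_wpM2l ?ler_powRDn//; last lra.
  by rewrite divr_ge0//; lra.
have sum_beta : \sum_(0 <= k < K) tau k * beta k <=
    t * a * (c0 * (K%:R + b) `^ (1 - delta)).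
  rewrite (eq_bigr (fun k => t * a * (k%:R + b) `^ (- delta))); last first.
    by move=> k _; rewrite tauE betaE powRN mulrA.
  rewrite -mulr_sumr ler_wpM2l ?mulr_ge0 ?(ltW t0) ?(ltW a0)//.
  have d1 : delta != 1 by rewrite lt_eqF.
  apply: le_trans (sum_powR_le _ _ K delta0 d1 b0) _.
  have d0 : 0 <= 1 - delta by lra.
  have := ler_powRDn _ _ _ _ K0 b0 d0; rewrite powRr0 => x1.
  rewrite /c0 [leRHS]mulrDl lerD//; first by rewrite ler_peMr ?powR_ge0.
  by rewrite mulrC ler_wpM2l ?invr_ge0// lerBlDr lerDl powR_ge0.
have T2 : (\sum_(0 <= k < K) tau k * beta k) / T <=
    t * a * c0 * c * (K%:R + b) `^ (- delta).
  rewrite ler_pdivrMr//; apply: le_trans sum_beta _.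
  rewrite -ler_pdivrMr//.
  have := ler_wpM2l (mulr_ge0 (mulr_ge0 (ltW t0) (ltW a0)) c00) (Tx (1 - delta)).
  by rewrite -/c (_ : 1 - delta - 1 = - delta); [rewrite [T^-1 * _]mulrC !mulrA | ring].
have main_real : 7 / (4 * T) * m + 7 / (2 * T * (1 - gamma)) * M
    + C * ((\sum_(0 <= k < K) tau k * beta k) / T)
    + 7 / (2 * T * (1 - gamma)) * e
    <= (A * c + C * (t * a * c0 * c)) * (K%:R + b) `^ (- delta).
  rewrite [leRHS]mulrDl -!(mulrA A) -!(mulrA C).
  rewrite [leLHS](_ : _ = A * T^-1 + C * ((\sum_(0 <= k < K) tau k * beta k) / T)).
    by rewrite lerD// ler_wpM2l// ltW.
  by rewrite /A; field; rewrite ?gt_eqF.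
apply: (le_trans _ (_ : (_ : R)%:E <= _)%E); last first.
  by rewrite lee_fin; exact: main_real.
rewrite /WFeas -/T !EFinD; apply: leeD2r; apply: leeD2r.
rewrite (EFinM _ m) (EFinM _ M); apply: leeD; apply: lee_wpmul2l => //.
  by rewrite lee_fin divr_ge0// mulr_ge0// ltW.
by rewrite lee_fin divr_ge0// !mulr_ge0// ltW.
Qed.

(** Each factor [(beta K)^-1] costs a power [delta] of [K + b], and the slowest
    terms have two of them. *)
Lemma WOpt_le_bigO {R : realType} {n : nat} (tau beta : nat -> R)
    (h : nat -> \bar R) (gamma C t a b delta M m : R) (x0 xs : 'rV[R]_n)
    (U S : set 'rV[R]_n) :
  (forall k, tau k = t) -> (forall k, beta k = a / (k%:R + b) `^ delta) ->
  0 < t -> 0 < a -> 0 < b -> 0 < delta -> gamma < 1 -> 0 < C ->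
  0 <= M -> (\sum_(0 <= k <oo) (tau k)%:E * h k <= M%:E)%E ->
  0 <= m -> (maxdist2 (U `&` S) x0 <= m%:E)%E ->
  le_bigO (fun K => WOpt tau beta h gamma C K x0 xs U S)
          (fun K => (K%:R + b) `^ (- (1 - 2 * delta))).
Proof.
move=> tauE betaE t0 a0 b0 delta0 gamma1 C0 M0 HM m0 Hm.
have g0 : 0 < 1 - gamma by lra.
pose e := enorm (xs - x0) ^+ 2.
pose c := (1 + b) / t.
have c_ge0 : 0 <= c by rewrite divr_ge0//; lra.
pose A := 7 / (2 * (1 - gamma)) * (e + M).
have A0 : 0 <= A.
  rewrite mulr_ge0// ?divr_ge0 ?mulr_ge0 ?(ltW g0)//.
  by rewrite addr_ge0 ?sqr_ge0.
apply: (@le_bigO_scale _ _ _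
  (C / 2 * (c / a) + 3 / 4 * m * c + A * (c / a ^+ 2))) => K K0.
have T0 : 0 < sumT tau K by rewrite (sumT_cst _ _ _ tauE) mulr_gt0 ?ltr0n.
have beta0 : 0 < beta K.
  by rewrite betaE divr_gt0// powR_gt0// ltr_wpDl.
have betaV : (beta K)^-1 = (K%:R + b) `^ delta / a by rewrite betaE invf_div.
have Tx (q : R) : q <= 2 * delta -> (sumT tau K)^-1 * (K%:R + b) `^ q
    <= c * (K%:R + b) `^ (- (1 - 2 * delta)).
  move=> q_le; apply: le_trans (sumTV_powR_le _ _ _ q _ tauE K0 b0 t0) _.
  rewrite ler_wpM2l ?ler_powRDn//; lra.
set T := sumT tau K in T0 Tx *.
set r := (K%:R + b) `^ (- _) in Tx *.
have T1 : T^-1 <= c * r.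
  by have := Tx 0; rewrite powRr0 mulr1; apply; lra.
have T2 : T^-1 * (beta K)^-1 <= c / a * r.
  rewrite betaV mulrA [leRHS]mulrAC ler_wpM2r ?invr_ge0 ?(ltW a0)//.
  by apply: Tx; lra.
have T3 : T^-1 * (beta K)^-1 ^+ 2 <= c / a ^+ 2 * r.
  rewrite betaV expr_div_n mulrA [leRHS]mulrAC.
  rewrite ler_wpM2r ?invr_ge0 ?exprn_ge0 ?(ltW a0)//.
  by rewrite -powR_mulrn ?powR_ge0// -powRrM; apply: Tx; lra.
have main_real : C / (2 * T * beta K) + 3 / (4 * T) * m
    + 7 / (2 * (1 - gamma) * T * beta K ^+ 2) * e
    + 7 / (2 * (1 - gamma) * T * beta K ^+ 2) * M
    <= (C / 2 * (c / a) + 3 / 4 * m * c + A * (c / a ^+ 2)) * r.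
  rewrite [leLHS](_ : _ = C / 2 * (T^-1 * (beta K)^-1) + 3 / 4 * m * T^-1
      + A * (T^-1 * (beta K)^-1 ^+ 2)); last first.
    by rewrite /A; field; rewrite ?gt_eqF.
  rewrite [leRHS]mulrDl; apply: lerD; first (rewrite [leRHS]mulrDl; apply: lerD).
  - by rewrite -[leRHS]mulrA ler_wpM2l// divr_ge0// ltW.
  - by rewrite -[leRHS]mulrA ler_wpM2l// mulr_ge0.
  - by rewrite -[leRHS]mulrA ler_wpM2l.
apply: (le_trans _ (_ : (_ : R)%:E <= _)%E); last first.
  by rewrite lee_fin; exact: main_real.
rewrite /WOpt -/T !EFinD; apply: leeD; first apply: leeD2r.
  apply: leeD2l.
  rewrite (EFinM _ m); apply: lee_wpmul2l => //; rewrite lee_fin.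
  by rewrite divr_ge0// mulr_ge0// ltW.
rewrite (EFinM _ M); apply: lee_wpmul2l => //; rewrite lee_fin.
by rewrite divr_ge0// !mulr_ge0 ?exprn_ge0// ltW.
Qed.

Theorem proposition2p7 (R : realType) (n : nat)
  (F1 F2 : 'rV[R]_n -> 'rV[R]_n) (g1 g2 : 'rV[R]_n -> \bar R)
  (S1 S2 : set 'rV[R]_n)
  (S2_def : S2 = lower_sol F2 g2)
  (S1_def : S1 = hier_sol F1 g1 S2)
  (S1_neq0 : S1 !=set0)
  (g1_proper : proper_fun g1) (g1_convex : convex_fun g1)
  (g1_lsc : lower_semicontinuous g1)
  (g2_proper : proper_fun g2) (g2_convex : convex_fun g2)
  (g2_lsc : lower_semicontinuous g2)
  (LF1 LF2 : R)
  (F1_mono : monotone_op F1) (F1_lip : lipschitz_op LF1 F1)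
  (F2_mono : monotone_op F2) (F2_lip : lipschitz_op LF2 F2)
  (A : finType) (F1a F2a : A -> 'rV[R]_n -> 'rV[R]_n)
  (F1_sum : forall x, F1 x = \sum_(i : A) F1a i x)
  (F2_sum : forall x, F2 x = \sum_(i : A) F2a i x)
  (dom_closed : closed (dom g1 `&` dom g2))
  (g1_osc : forall B C : set 'rV[R]_n, compact B -> compact C ->
     B `<=` dom g1 `&` dom g2 -> C `<=` dom g1 `&` dom g2 ->
     (ereal_sup [set `|g1 x - g1 y| | x in B & y in C] < +oo)%E)
  (S1_zer : S1 = zer (add_op (add_op (single_op F1) (subdiff g1))
                             (normal_cone S2)))
  (kappa rho rhos : R) (kappa_gt0 : 0 < kappa) (rho_gt1 : 1 < rho)
  (rho_lt2 : rho < 2) (rhos_def : rhos^-1 = 1 - rho^-1)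
  (S2_sharp : weakly_sharp F2 g2 S2 kappa rho)
  (theta alpha gamma taubar a b delta L1 : R)
  (theta_gt0 : 0 < theta) (theta_le1 : theta <= 1)
  (alpha_def : alpha = 1 - theta)
  (gamma_gt0 : 0 < gamma) (gamma_lt1 : gamma < 1)
  (taubar_gt0 : 0 < taubar) (taubar_le : taubar <= Num.sqrt theta * gamma / L1)
  (a_gt0 : 0 < a) (b_gt0 : 0 < b)
  (delta_gt0 : 0 < delta) (delta_lt : delta < 2^-1) (delta_gt : rhos^-1 < delta)
  (tau beta : nat -> R)
  (tau_def : forall k, tau k = taubar)
  (beta_def : forall k, beta k = a / (k%:R + b) `^ delta)
  (dXi : measure_display) (Xi : measurableType dXi) (Q : probability Xi R)
  (Vs : nat -> Xi -> 'rV[R]_n -> 'rV[R]_n) (L : nat -> R)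
  (L_gt0 : forall k, 0 < L k) (L_le : forall k, L k <= L1)
  (oracle : forall k, stochastic_oracle Q (combV beta F1 F2 k) (Vs k) (L k))
  (dO : measure_display) (Omega : measurableType dO) (P : probability Omega R)
  (x0 : 'rV[R]_n) (xi : nat -> Omega -> Xi) (coin : nat -> Omega -> bool)
  (x y w : nat -> Omega -> 'rV[R]_n)
  (run : algorithm_run P Q (combV beta F1 F2) (combG beta g1 g2) Vs
           tau alpha theta x0 xi coin x y w)
  (U1 U2 : set 'rV[R]_n)
  (U1_dom : U1 `<=` dom g1) (U1_neq0 : U1 !=set0) (U1_compact : compact U1)
  (U1_S1 : U1 `&` S1 !=set0)
  (U2_dom : U2 `<=` dom g2) (U2_neq0 : U2 !=set0) (U2_compact : compact U2)
  (U2_S2 : U2 `&` S2 !=set0)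
  (xs ps : 'rV[R]_n) (xs_S1 : S1 xs) (ps_N : normal_cone S2 xs ps)
  (h : nat -> \bar R) (h_def : forall k, h k = hseq F2 g2 S2 beta ps k)
  (CU1 CU2 : R) (CU1_gt0 : 0 < CU1) (CU2_gt0 : 0 < CU2)
  (feas_bound : forall K, (0 < K)%N ->
     (\int[P]_o Theta F2 g2 U2 (ybar tau y K o)
        <= WFeas tau beta h gamma CU2 K x0 xs U2)%E)
  (opt_bound : forall K, (0 < K)%N ->
     (\int[P]_o Theta F1 g1 (U1 `&` S2) (ybar tau y K o)
        <= WOpt tau beta h gamma CU1 K x0 xs U1 S2)%E) :
  le_bigO (fun K => WFeas tau beta h gamma CU2 K x0 xs U2)
          (fun K => (K%:R + b) `^ (- delta)) /\
  le_bigO (fun K => WOpt tau beta h gamma CU1 K x0 xs U1 S2)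
          (fun K => (K%:R + b) `^ (- (1 - 2 * delta))).
Proof.
have pN : normal_cone (lower_sol F2 g2) xs ps by rewrite -S2_def.
have sharp : weakly_sharp F2 g2 (lower_sol F2 g2) kappa rho by rewrite -S2_def.
have [M M_ge0] := nneseries_hseq_le _ _ _ _ _ _ _ _ _ _ _ _ _ g2_proper F2_mono
  kappa_gt0 rho_gt1 rhos_def delta_gt sharp pN taubar_gt0 a_gt0 b_gt0
  tau_def beta_def.
rewrite -S2_def -(funext h_def) => HM.
have [m2 m2_ge0 Hm2] := maxdist2_le U2 x0 U2_compact.
have [m1 m1_ge0 Hm1] := maxdist2_le U1 x0 U1_compact.
have Hm12 : (maxdist2 (U1 `&` S2) x0 <= m1%:E)%E.
  by apply: le_trans Hm1; apply: ereal_sup_le => _ [z [U1z _] <-]; exists z.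
have delta_lt1 : 0 < delta < 1 by apply/andP; split; lra.
split.
  exact: WFeas_le_bigO tau_def beta_def taubar_gt0 a_gt0 b_gt0 delta_lt1
    gamma_lt1 CU2_gt0 M_ge0 HM m2_ge0 Hm2.
exact: WOpt_le_bigO tau_def beta_def taubar_gt0 a_gt0 b_gt0 delta_gt0
  gamma_lt1 CU1_gt0 M_ge0 HM m1_ge0 Hm12.
Qed.
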